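(* Let $\mathcal G$ be a subcategory of the category of commutative rings. For every $R\in\mathcal G$ let $\mathcal T_R$ be an affine Grothendieck topology of finite type on $\operatorname{Spec} R$, and suppose that every ring homomorphism $R\to S$ in $\mathcal G$ induces a site morphism $(\operatorname{Spec} S)_{\mathrm{top}}\to(\operatorname{Spec} R)_{\mathrm{top}}$. Then the closure operation $N\mapsto N^{\mathrm{top-cl}}$ induced by the Grothendieck topology is a $\mathcal G$-admissible closure operation for all submodules $N\subseteq M$ of all $R$-modules $M$, $R\in\mathcal G$.
   Context: Grothendieck topology on a scheme $X$: a category $\mathcal T_X$ of schemes over $X$ (with certain $X$-morphisms), containing $X$ and closed under fibre products of schemes, with a collection of coverings (families $U_i\to U$, $i\in I$, in $\mathcal T_X$) such that isomorphisms are coverings, coverings are stable under composition, and coverings are stable under base change in $\mathcal T_X$. It is affine if all structural morphisms $U\to X$ are affine, and of finite type if all its morphisms are of finite type. A ring homomorphism $R\to S$ induces a site morphism $(\operatorname{Spec} S)_{\mathrm{top}}\to(\operatorname{Spec} R)_{\mathrm{top}}$ if base change along $\operatorname{Spec} S\to\operatorname{Spec} R$ sends objects of $\mathcal T_R$ to objects of $\mathcal T_S$ and coverings to coverings. Induced closure: for $X=\operatorname{Spec} R$ and an $R$-module $M$ let $M_{\mathrm{top}}$ be the sheafification of the presheaf $\operatorname{Spec} S\mapsto M\otimes_R S$ on $\mathcal T_R$, with sheafification map $\theta:M\to\Gamma(X_{\mathrm{top}},M_{\mathrm{top}})$. For $N\subseteq M$ let $N^{\mathrm{top}}$ be the image sheaf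 of $N_{\mathrm{top}}\to M_{\mathrm{top}}$ and $N^{\mathrm{top-cl}}:=\theta^{-1}(\Gamma(X_{\mathrm{top}},N^{\mathrm{top}}))\subseteq M$. Forcing algebra: let $N\subseteq M$ be $R$-modules with $M/N$ finitely presented, $s\in M$. Choose a presentation $R^{\nu}\xrightarrow{D}R^{\mu}\to M/N\to 0$ and a lift $\tilde s\in R^\mu$ of the class of $s$. The forcing algebra for $(M,N,s)$ is $B=R[T_1,\dots,T_\nu]/(DT-\tilde s)$. Let $c$ be an assignment $N\mapsto N^c$ sending submodules $N\subseteq M$ to submodules $N^c\subseteq M$, for all $R\in\mathcal G$. A forcing algebra for $(M,N,s)$ is called $c$-admissible if $s\in N^c$. A ring homomorphism $R\to A$ is called $c$-pure if for all $R$-modules $U\subseteq V$ and $z\in V$: $z\otimes 1\in\operatorname{im}(U\otimes_R A\to V\otimes_R A)$ implies $z\in U^c$. The assignment $c$ is called $\mathcal G$-admissible if (i) $N\subseteq N^c=(N^c)^c$ always; (ii) every $c$-admissible forcing algebra $R\to B$ is $c$-pure; (iii) ($\mathcal G$-persistence) for $R\to S$ in $\mathcal G$ and $N\subseteq M$, the image of $N^c$ in $M\otimes_R S$ lies in $(N')^c$, where $N'=\operatorname{im}(N\otimes_R S\to M\otimes_R S)$. *)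

(* Defs.v *)
From HB Require Import structures.
From mathcomp Require Import all_boot all_order all_algebra.
From mathcomp Require Import generic_quotient ring_quotient boolp.

Set Implicit Arguments.
Unset Strict Implicit.
Unset Printing Implicit Defensive.

Import GRing.Theory.
Local Open Scope ring_scope.
Local Open Scope quotient_scope.

(* Rings are [comPzRingType]: the zero ring is allowed. *)

Record is_equiv (T : Type) (e : T -> T -> Prop) : Prop := IsEquiv {
  eqv_refl : forall x, e x x;
  eqv_sym : forall x y, e x y -> e y x;
  eqv_trans : forall x y z, e x y -> e y z -> e x z }.

Section Quotient.
Variables (T : Type) (e : T -> T -> Prop) (eqe : is_equiv e).

Definition qrel : rel {classic T} := fun x y => `[< e x y >].

Lemma qrel_class : equiv_class_of qrel.
Proof.
split=> [x|x y|y x z]; first by apply/asboolP/(eqv_refl eqe).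
  by apply/asboolP/asboolP; apply: eqv_sym.
by move=> /asboolP xy /asboolP yz; apply/asboolP; apply: eqv_trans xy yz.
Qed.

Definition qequiv := EquivRelPack qrel_class.
Definition quotient := {eq_quot qequiv}.
HB.instance Definition _ := Choice.on quotient.

Definition cls (x : T) : quotient := \pi_({eq_quot qequiv}) (x : {classic T}).
Definition rep (c : quotient) : T := repr c.

Lemma repK c : cls (rep c) = c. Proof. exact: reprK. Qed.

Lemma clsP x y : cls x = cls y <-> e x y.
Proof. by split=> [/eqmodP/asboolP|exy]; [|apply/eqmodP/asboolP]. Qed.

Lemma rep_cls x : e (rep (cls x)) x. Proof. by apply/clsP; rewrite repK. Qed.

Lemma clsW (P : quotient -> Prop) : (forall x, P (cls x)) -> forall c, P c.
Proof. by move=> Px c; rewrite -(repK c). Qed.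
End Quotient.

(* The same construction without a [choiceType] structure, for types that live in
   a larger universe than the carriers of the algebraic structures. *)
Section Classes.
Variables (T : Type) (e : T -> T -> Prop) (eqe : is_equiv e).

Definition classes := {c : T -> Prop | exists x, c = e x}.
Definition eclass (x : T) : classes := exist _ (e x) (ex_intro _ x erefl).
Definition erep (c : classes) : T := sval (cid (svalP c)).

Lemma erepK c : eclass (erep c) = c.
Proof.
case: c => c cP; rewrite /erep /=; case: (cid _) => x /= cx.
by move: cP; rewrite cx => cP; congr exist; apply: Prop_irrelevance.
Qed.

Lemma eclassP x y : eclass x = eclass y <-> e x y.
Proof.
split=> [[exy]|exy]; first by rewrite exy; apply: eqv_refl.
have exy' : e x = e y.
  apply: funext => z; apply: propext; split; first exact/(eqv_trans eqe)/(eqv_sym eqe).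
  exact: (eqv_trans eqe).
by rewrite /eclass; move: (ex_intro _ x _); rewrite exy' => cP;
  congr exist; apply: Prop_irrelevance.
Qed.

Lemma erep_class x : e (erep (eclass x)) x. Proof. by apply/eclassP; rewrite erepK. Qed.

Lemma eclassW (P : classes -> Prop) : (forall x, P (eclass x)) -> forall c, P c.
Proof. by move=> Px c; rewrite -(erepK c). Qed.
End Classes.

Section Submodule.
Variables (R : comPzRingType) (M : lmodType R).

Record submodule := Submodule {
  sm_pred :> {pred M};
  sm_closed : submod_closed sm_pred }.

Section One.
Variable N : submodule.
HB.instance Definition _ := GRing.isSubmodClosed.Build R M (sm_pred N) (sm_closed N).

Definition submod := {x : M | x \in sm_pred N}.
HB.instance Definition _ := SubChoice.on submod.
HB.instance Definition _ := [SubChoice_isSubZmodule of submod by <:].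
HB.instance Definition _ := [SubZmodule_isSubLmodule of submod by <:].
Definition submod_incl : {linear submod -> M} := val.

Definition quotmod := (Quotient.quot N).
HB.instance Definition _ := GRing.Zmodule.on quotmod.
Definition qmod_class (x : M) : quotmod := \pi_(Quotient.quot N) x.

Lemma qmod_classP x y : qmod_class x = qmod_class y <-> x - y \in N.
Proof.
by split=> [/eqP|xy]; [|apply/eqP]; rewrite /qmod_class -Quotient.idealrBE.
Qed.

Definition qmod_scale (a : R) (c : quotmod) : quotmod :=
  qmod_class (a *: (repr (c : (Quotient.quot N)))).

Lemma qmod_scaleE a x : qmod_scale a (qmod_class x) = qmod_class (a *: x).
Proof.
apply/qmod_classP; rewrite -scalerBr; apply: rpredZ.
by apply/qmod_classP; rewrite /qmod_class reprK.
Qed.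

Lemma qmod_classD x y : qmod_class (x + y) = qmod_class x + qmod_class y.
Proof. exact: Quotient.pi_add. Qed.

Lemma qmod_classW (P : quotmod -> Prop) : (forall x, P (qmod_class x)) -> forall c, P c.
Proof. by move=> Px c; rewrite -[c](@reprK _ (Quotient.quot N)); apply: Px. Qed.

Fact qmod_scaleA a b c : qmod_scale a (qmod_scale b c) = qmod_scale (a * b) c.
Proof. by elim/qmod_classW: c => x; rewrite !qmod_scaleE scalerA. Qed.
Fact qmod_scale1 : left_id 1 qmod_scale.
Proof. by elim/qmod_classW => x; rewrite qmod_scaleE scale1r. Qed.
Fact qmod_scaleDr : right_distributive qmod_scale +%R.
Proof.
move=> a; elim/qmod_classW => x; elim/qmod_classW => y.
by rewrite -qmod_classD !qmod_scaleE scalerDr qmod_classD.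
Qed.
Fact qmod_scaleDl c : {morph qmod_scale^~ c : a b / a + b}.
Proof.
move=> a b; elim/qmod_classW: c => x.
by rewrite !qmod_scaleE scalerDl qmod_classD.
Qed.
HB.instance Definition _ := GRing.Zmodule_isLmodule.Build R quotmod
  qmod_scaleA qmod_scale1 qmod_scaleDr qmod_scaleDl.
End One.
End Submodule.

(* A list of pairs stands for the sum of the corresponding pure tensors. *)
Section TensorRel.
Variables (R S : comPzRingType) (f : {rmorphism R -> S}) (M : lmodType R).

Inductive tens_rel : seq (M * S) -> seq (M * S) -> Prop :=
| tr_refl u : tens_rel u u
| tr_sym u v : tens_rel u v -> tens_rel v u
| tr_trans u v w : tens_rel u v -> tens_rel v w -> tens_rel u w
| tr_cat u u' v v' : tens_rel u u' -> tens_rel v v' -> tens_rel (u ++ v) (u' ++ v')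
| tr_comm u v : tens_rel (u ++ v) (v ++ u)
| tr_zero s : tens_rel [:: (0, s)] [::]
| tr_addl m m' s : tens_rel [:: (m + m', s)] [:: (m, s); (m', s)]
| tr_addr m s s' : tens_rel [:: (m, s + s')] [:: (m, s); (m, s')]
| tr_bal a m s : tens_rel [:: (a *: m, s)] [:: (m, f a * s)].

Lemma tens_rel_equiv : is_equiv tens_rel.
Proof. by split; [apply: tr_refl|apply: tr_sym|apply: tr_trans]. Qed.
End TensorRel.

Section Tensor.
Variables (R S : comPzRingType) (f : {rmorphism R -> S}) (M : lmodType R).

(* M ⊗_R S for S viewed as an R-algebra through f, with its S-module structure *)
Definition tensor := quotient (tens_rel_equiv f M).
Implicit Types (u v w : seq (M * S)) (x y z : tensor).

Definition tcls u : tensor := cls (tens_rel_equiv f M) u.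
Definition pure (m : M) (s : S) : tensor := tcls [:: (m, s)].

Lemma tclsP u v : tcls u = tcls v <-> tens_rel f u v. Proof. exact: clsP. Qed.
Lemma tclsW (P : tensor -> Prop) : (forall u, P (tcls u)) -> forall x, P x.
Proof. exact: clsW. Qed.
Lemma rep_tcls u : tens_rel f (rep (tcls u)) u. Proof. exact: rep_cls. Qed.

Definition tmap (g : S -> S) u := [seq (p.1, g p.2) | p <- u].

Lemma tmap_rel (g : S -> S) u v : {morph g : a b / a + b} ->
  (forall a s, g (f a * s) = f a * g s) ->
  tens_rel f u v -> tens_rel f (tmap g u) (tmap g v).
Proof.
move=> gD gZ; elim=> /= {u v}.
- by move=> u; apply: tr_refl.
- by move=> u v _; apply: tr_sym.
- by move=> u v w _ uv _; apply: tr_trans.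
- by move=> u u' v v' _ uu' _ vv'; rewrite /tmap !map_cat; apply: tr_cat.
- by move=> u v; rewrite /tmap !map_cat; apply: tr_comm.
- by move=> s; apply: tr_zero.
- by move=> m m' s; apply: tr_addl.
- by move=> m s s'; rewrite gD; apply: tr_addr.
- by move=> a m s; rewrite gZ; apply: tr_bal.
Qed.

Definition tadd x y : tensor := tcls (rep x ++ rep y).
Definition tzero : tensor := tcls [::].
Definition tscale (a : S) x : tensor := tcls (tmap ( *%R a) (rep x)).
Definition topp x : tensor := tscale (-1) x.

Lemma taddE u v : tadd (tcls u) (tcls v) = tcls (u ++ v).
Proof. by apply/tclsP/tr_cat; apply: rep_tcls. Qed.

Lemma tscaleE a u : tscale a (tcls u) = tcls (tmap ( *%R a) u).
Proof.
apply/tclsP/tmap_rel; [exact: mulrDr| by move=> b s; rewrite mulrCA |].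
exact: rep_tcls.
Qed.

Fact taddA : associative tadd.
Proof. by elim/tclsW=> u; elim/tclsW=> v; elim/tclsW=> w; rewrite !taddE catA. Qed.
Fact taddC : commutative tadd.
Proof. by elim/tclsW=> u; elim/tclsW=> v; rewrite !taddE; apply/tclsP/tr_comm. Qed.
Fact tadd0 : left_id tzero tadd.
Proof. by elim/tclsW=> u; rewrite taddE. Qed.

Lemma tens_pure0 (m : M) : tens_rel f [:: (m, 0)] [::].
Proof.
apply: tr_trans (tr_zero f M 0); apply: tr_sym.
by rewrite -(scale0r m); apply: tr_trans (tr_bal _ _ _ _) _; rewrite mulr0; apply: tr_refl.
Qed.

Fact tscaleDl x : {morph tscale^~ x : a b / a + b >-> tadd a b}.
Proof.
move=> a b; elim/tclsW: x => u; rewrite !tscaleE taddE; apply/tclsP.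
elim: u => [|[m s] u IHu] /=; first exact: tr_refl.
apply: (@tr_trans _ _ _ _ _ ([:: (m, a * s); (m, b * s)] ++ (tmap ( *%R a) u ++ tmap ( *%R b) u))).
  rewrite -cat1s; apply: tr_cat IHu.
  by rewrite mulrDl; apply: tr_addr.
rewrite /= -[X in tens_rel _ _ X]cat1s -[X in tens_rel _ X _]cat1s.
apply: tr_cat; first exact: tr_refl.
rewrite -[X in tens_rel _ _ (_ ++ X)]cat1s -[X in tens_rel _ X _]cat1s !catA.
by apply: tr_cat; [apply: tr_comm|apply: tr_refl].
Qed.

Fact tscale1 : left_id 1 tscale.
Proof.
elim/tclsW=> u; rewrite tscaleE; congr tcls.
by elim: u => [|[m s] u IHu] //=; rewrite mul1r IHu.
Qed.

Fact tscaleA a b x : tscale a (tscale b x) = tscale (a * b) x.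
Proof.
elim/tclsW: x => u; rewrite !tscaleE /tmap -map_comp; congr tcls.
by apply: eq_map => -[m s] /=; rewrite mulrA.
Qed.

Fact tscaleDr : right_distributive tscale tadd.
Proof.
by move=> a; elim/tclsW=> u; elim/tclsW=> v; rewrite !(tscaleE, taddE) /tmap map_cat.
Qed.

Lemma tscale0 x : tscale 0 x = tzero.
Proof.
elim/tclsW: x => u; rewrite tscaleE; apply/tclsP.
elim: u => [|[m s] u IHu] /=; first exact: tr_refl.
by rewrite -cat1s -[[::]]cats0 mul0r; apply: tr_cat IHu; apply: tens_pure0.
Qed.

Fact taddN : left_inverse tzero topp tadd.
Proof.
by move=> x; rewrite -{2}(tscale1 x) /topp -tscaleDl addNr tscale0.
Qed.

HB.instance Definition _ := Choice.on tensor.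
HB.instance Definition _ := GRing.isZmodule.Build tensor taddA taddC tadd0 taddN.
HB.instance Definition _ := GRing.Zmodule_isLmodule.Build S tensor
  tscaleA tscale1 tscaleDr tscaleDl.
End Tensor.

(* φ ⊗ g : M ⊗_R S -> M' ⊗_R S' for an R-linear φ and an R-algebra map g *)
Section TensorMap.
Variables (R S S' : comPzRingType) (f : {rmorphism R -> S}) (f' : {rmorphism R -> S'}).
Variables (M M' : lmodType R) (phi : {linear M -> M'}) (g : {rmorphism S -> S'}).
Hypothesis gf : forall a, g (f a) = f' a.

Definition tens_map (x : tensor f M) : tensor f' M' :=
  tcls f' [seq (phi p.1, g p.2) | p <- rep x].

Lemma tens_map_rel (u v : seq (M * S)) : tens_rel f u v ->
  tens_rel f' [seq (phi p.1, g p.2) | p <- u] [seq (phi p.1, g p.2) | p <- v].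
Proof.
elim=> /= {u v}.
- by move=> u; apply: tr_refl.
- by move=> u v _; apply: tr_sym.
- by move=> u v w _ uv _; apply: tr_trans.
- by move=> u u' v v' _ uu' _ vv'; rewrite !map_cat; apply: tr_cat.
- by move=> u v; rewrite !map_cat; apply: tr_comm.
- by move=> s; rewrite linear0; apply: tr_zero.
- by move=> m m' s; rewrite linearD; apply: tr_addl.
- by move=> m s s'; rewrite rmorphD; apply: tr_addr.
- by move=> a m s; rewrite linearZ rmorphM gf; apply: tr_bal.
Qed.

Lemma tens_mapE u : tens_map (tcls f u) = tcls f' [seq (phi p.1, g p.2) | p <- u].
Proof. by apply/tclsP/tens_map_rel/rep_tcls. Qed.
End TensorMap.

Section Extension.
Variables (R S : comPzRingType) (f : {rmorphism R -> S}) (M : lmodType R).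
Variable N : submodule M.

(* N ⊗_R S -> M ⊗_R S *)
Definition tens_incl : tensor f (submod N) -> tensor f M :=
  tens_map f (submod_incl N) idfun.

Definition ext_pred : {pred tensor f M} :=
  fun y => `[< exists x, tens_incl x = y >].

Lemma tens_inclE u :
  tens_incl (tcls f u) = tcls f [seq (val p.1, p.2) | p <- u].
Proof. exact: tens_mapE. Qed.

Lemma ext_closed : submod_closed ext_pred.
Proof.
split=> [|a _ _ /asboolP[x <-] /asboolP[y <-]]; apply/asboolP.
  by exists (tcls f [::]); rewrite tens_inclE.
elim/tclsW: x => u; elim/tclsW: y => v.
exists (tcls f (tmap ( *%R a) u ++ v)).
rewrite !tens_inclE map_cat -taddE.
congr (tadd _ _); rewrite /GRing.scale /= tscaleE; congr tcls.
by rewrite /tmap -!map_comp; apply: eq_map => -[].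
Qed.

(* N' = im(N ⊗_R S -> M ⊗_R S) *)
Definition ext_submodule := Submodule ext_closed.
End Extension.

(* R[T_1..T_n]/(l = r, (l, r) in E): terms modulo the axioms of commutative
   rings, the ring structure of R and the relations E *)
Section PresentedAlgebra.
Variables (R : comPzRingType) (n : nat).

Inductive pterm :=
| PConst of R | PVar of 'I_n
| PAdd of pterm & pterm | POpp of pterm | PMul of pterm & pterm.

Variable E : pterm -> pterm -> Prop.

Inductive pres_rel : pterm -> pterm -> Prop :=
| pr_refl x : pres_rel x x
| pr_sym x y : pres_rel x y -> pres_rel y x
| pr_trans x y z : pres_rel x y -> pres_rel y z -> pres_rel x z
| pr_add x x' y y' : pres_rel x x' -> pres_rel y y' -> pres_rel (PAdd x y) (PAdd x' y')
| pr_opp x x' : pres_rel x x' -> pres_rel (POpp x) (POpp x')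
| pr_mul x x' y y' : pres_rel x x' -> pres_rel y y' -> pres_rel (PMul x y) (PMul x' y')
| pr_addA x y z : pres_rel (PAdd x (PAdd y z)) (PAdd (PAdd x y) z)
| pr_addC x y : pres_rel (PAdd x y) (PAdd y x)
| pr_add0 x : pres_rel (PAdd (PConst 0) x) x
| pr_addN x : pres_rel (PAdd (POpp x) x) (PConst 0)
| pr_mulA x y z : pres_rel (PMul x (PMul y z)) (PMul (PMul x y) z)
| pr_mulC x y : pres_rel (PMul x y) (PMul y x)
| pr_mul1 x : pres_rel (PMul (PConst 1) x) x
| pr_mulDl x y z : pres_rel (PMul (PAdd x y) z) (PAdd (PMul x z) (PMul y z))
| pr_constD a b : pres_rel (PConst (a + b)) (PAdd (PConst a) (PConst b))
| pr_constM a b : pres_rel (PConst (a * b)) (PMul (PConst a) (PConst b))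
| pr_E x y : E x y -> pres_rel x y.

Lemma pres_rel_equiv : is_equiv pres_rel.
Proof. by split; [apply: pr_refl|apply: pr_sym|apply: pr_trans]. Qed.

Definition pres_alg := quotient pres_rel_equiv.
Definition pcls (x : pterm) : pres_alg := cls pres_rel_equiv x.
Lemma pclsP x y : pcls x = pcls y <-> pres_rel x y. Proof. exact: clsP. Qed.
Lemma pclsW (P : pres_alg -> Prop) : (forall u, P (pcls u)) -> forall x, P x.
Proof. exact: clsW. Qed.
Lemma rep_pcls u : pres_rel (rep (pcls u)) u. Proof. exact: rep_cls. Qed.

Definition padd (x y : pres_alg) : pres_alg := pcls (PAdd (rep x) (rep y)).
Definition popp (x : pres_alg) : pres_alg := pcls (POpp (rep x)).
Definition pmul (x y : pres_alg) : pres_alg := pcls (PMul (rep x) (rep y)).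

Lemma paddE x y : padd (pcls x) (pcls y) = pcls (PAdd x y).
Proof. by apply/pclsP/pr_add; apply: rep_pcls. Qed.
Lemma poppE x : popp (pcls x) = pcls (POpp x).
Proof. by apply/pclsP/pr_opp; apply: rep_pcls. Qed.
Lemma pmulE x y : pmul (pcls x) (pcls y) = pcls (PMul x y).
Proof. by apply/pclsP/pr_mul; apply: rep_pcls. Qed.

Fact paddA : associative padd.
Proof.
elim/pclsW=> x; elim/pclsW=> y; elim/pclsW=> z.
by rewrite !paddE; apply/pclsP/pr_addA.
Qed.
Fact paddC : commutative padd.
Proof. by elim/pclsW=> x; elim/pclsW=> y; rewrite !paddE; apply/pclsP/pr_addC. Qed.
Fact padd0 : left_id (pcls (PConst 0)) padd.
Proof. by elim/pclsW=> x; rewrite paddE; apply/pclsP/pr_add0. Qed.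
Fact paddN : left_inverse (pcls (PConst 0)) popp padd.
Proof. by elim/pclsW=> x; rewrite poppE paddE; apply/pclsP/pr_addN. Qed.
Fact pmulA : associative pmul.
Proof.
elim/pclsW=> x; elim/pclsW=> y; elim/pclsW=> z.
by rewrite !pmulE; apply/pclsP/pr_mulA.
Qed.
Fact pmulC : commutative pmul.
Proof. by elim/pclsW=> x; elim/pclsW=> y; rewrite !pmulE; apply/pclsP/pr_mulC. Qed.
Fact pmul1 : left_id (pcls (PConst 1)) pmul.
Proof. by elim/pclsW=> x; rewrite pmulE; apply/pclsP/pr_mul1. Qed.
Fact pmulDl : left_distributive pmul padd.
Proof.
elim/pclsW=> x; elim/pclsW=> y; elim/pclsW=> z.
by rewrite !(paddE, pmulE); apply/pclsP/pr_mulDl.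
Qed.

HB.instance Definition _ := Choice.on pres_alg.
HB.instance Definition _ := GRing.isZmodule.Build pres_alg paddA paddC padd0 paddN.
HB.instance Definition _ := GRing.Zmodule_isComPzRing.Build pres_alg
  pmulA pmulC pmul1 pmulDl.

Definition pres_const (a : R) : pres_alg := pcls (PConst a).

Fact pres_const_nmod : nmod_morphism pres_const.
Proof.
by split=> // a b; rewrite /pres_const /GRing.add /= paddE; apply/pclsP/pr_constD.
Qed.
Fact pres_const_monoid : monoid_morphism pres_const.
Proof.
by split=> // a b; rewrite /pres_const /GRing.mul /= pmulE; apply/pclsP/pr_constM.
Qed.
HB.instance Definition _ := GRing.isNmodMorphism.Build R pres_alg pres_const pres_const_nmod.
HB.instance Definition _ := GRing.isMonoidMorphism.Build R pres_alg pres_const pres_const_monoid.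
End PresentedAlgebra.

Section Forcing.
Variables (R : comPzRingType).

(* R^nu -D-> R^mu -p-> Q -> 0 is exact *)
Definition is_presentation (Q : lmodType R) (mu nu : nat) (D : 'M[R]_(mu, nu))
    (p : {linear 'cV[R]_mu -> Q}) : Prop :=
  (forall y, exists x, p x = y) /\
  (forall x, p x = 0 <-> exists v : 'cV[R]_nu, x = D *m v).

Variables (mu nu : nat) (D : 'M[R]_(mu, nu)) (s : 'cV[R]_mu).

Definition forcing_lhs (j : 'I_mu) : pterm R nu :=
  foldr (@PAdd R nu) (PConst nu 0)
    [seq PMul (PConst nu (D j i)) (PVar R i) | i <- enum 'I_nu].

Definition forcing_rel (l r : pterm R nu) : Prop :=
  exists j, l = forcing_lhs j /\ r = PConst nu (s j 0).

(* R[T_1..T_nu]/(DT - s) *)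
Definition forcing_alg := pres_alg forcing_rel.
HB.instance Definition _ := GRing.ComPzRing.on forcing_alg.
Definition forcing_str : {rmorphism R -> forcing_alg} := pres_const forcing_rel.
End Forcing.

Record category := Category {
  cat_ob :> Type;
  cat_hom : cat_ob -> cat_ob -> Type;
  cat_id : forall U, cat_hom U U;
  cat_comp : forall U V W, cat_hom V U -> cat_hom W V -> cat_hom W U;
  cat_id_l : forall U V (f : cat_hom V U), cat_comp (cat_id U) f = f;
  cat_id_r : forall U V (f : cat_hom V U), cat_comp f (cat_id V) = f;
  cat_assoc : forall U V W Z (f : cat_hom V U) (g : cat_hom W V) (h : cat_hom Z W),
    cat_comp f (cat_comp g h) = cat_comp (cat_comp f g) h }.
Arguments cat_id {c} U.
Arguments cat_comp {c U V W} f g.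

Record sieve (C : category) (U : C) := Sieve {
  sv_mem :> forall V : C, cat_hom V U -> Prop;
  sv_closed : forall (V W : C) (f : cat_hom V U) (g : cat_hom W V),
    sv_mem f -> sv_mem (cat_comp f g) }.
Arguments sv_mem {C U} s {V} f.

Section SieveOps.
Variable C : category.

Definition max_sieve (U : C) : sieve U :=
  @Sieve C U (fun _ _ => True) (fun _ _ _ _ _ => I).

Lemma pull_sieve_closed (U V : C) (S : sieve U) (h : cat_hom V U)
    (W Z : C) (f : cat_hom W V) (g : cat_hom Z W) :
  S W (cat_comp h f) -> S Z (cat_comp h (cat_comp f g)).
Proof. by rewrite cat_assoc; apply: sv_closed. Qed.

Definition pull_sieve (U V : C) (S : sieve U) (h : cat_hom V U) : sieve V :=
  @Sieve C V (fun W f => S W (cat_comp h f)) (pull_sieve_closed (S := S) (h := h)).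
End SieveOps.

Record site := Site {
  st_cat :> category;
  st_cov : forall U : st_cat, sieve U -> Prop;
  st_max : forall U : st_cat, st_cov (max_sieve U);
  st_pull : forall (U V : st_cat) (S : sieve U) (h : cat_hom V U),
    st_cov S -> st_cov (pull_sieve S h);
  st_trans : forall (U : st_cat) (S S' : sieve U), st_cov S ->
    (forall (V : st_cat) (h : cat_hom V U), S V h -> st_cov (pull_sieve S' h)) ->
    st_cov S' }.

Lemma sieve_ext (C : category) (U : C) (S S' : sieve U) :
  (forall (V : C) (f : cat_hom V U), S V f <-> S' V f) -> S = S'.
Proof.
case: S => p cp; case: S' => q cq /= pq.
have e : p = q.
  by apply: functional_extensionality_dep => V; apply: funext => f; apply: propext.
by move: cp cq; rewrite e => cp cq; congr Sieve; apply: Prop_irrelevance.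
Qed.

Lemma st_super (C : site) (U : C) (S S' : sieve U) : st_cov S ->
  (forall (V : C) (f : cat_hom V U), S V f -> S' V f) -> st_cov S'.
Proof.
move=> covS sub; apply: (st_trans covS) => V h /sub S'h.
suff -> : pull_sieve S' h = max_sieve V by apply: st_max.
by apply: sieve_ext => W f; split=> // _; apply: sv_closed.
Qed.

Record presheaf (C : category) := Presheaf {
  ps_val :> C -> Type;
  ps_res : forall U V : C, cat_hom V U -> ps_val U -> ps_val V;
  ps_res_id : forall U (x : ps_val U), ps_res (cat_id U) x = x;
  ps_res_comp : forall (U V W : C) (f : cat_hom V U) (g : cat_hom W V) x,
    ps_res (cat_comp f g) x = ps_res g (ps_res f x) }.
Arguments ps_res {C} p {U V} f x.

Record presheaf_hom (C : category) (F G : presheaf C) := PresheafHom {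
  ph_fun :> forall U : C, F U -> G U;
  ph_nat : forall (U V : C) (f : cat_hom V U) (x : F U),
    ph_fun (ps_res F f x) = ps_res G f (ph_fun x) }.
Arguments ph_fun {C F G} p U x.

(* F^+(U) = colim_S Match(S, F) over the covering sieves S of U: matching
   families, identified when they agree on a common covering subsieve. *)
Section Plus.
Variables (C : site) (F : presheaf C).

Record matching (U : C) := Matching {
  mt_sieve : sieve U;
  mt_cov : st_cov mt_sieve;
  mt_fam : forall (V : C) (f : cat_hom V U), mt_sieve V f -> F V;
  mt_nat : forall (V W : C) (f : cat_hom V U) (g : cat_hom W V)
      (Sf : mt_sieve V f) (Sfg : mt_sieve W (cat_comp f g)),
    mt_fam Sfg = ps_res F g (mt_fam Sf) }.

Definition match_eq (U : C) (x y : matching U) : Prop :=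
  exists2 S : sieve U, st_cov S &
    forall (V : C) (f : cat_hom V U), S V f ->
      exists (fx : mt_sieve x V f) (fy : mt_sieve y V f), mt_fam fx = mt_fam fy.

Lemma st_cov_meet (U : C) (S S' : sieve U) : st_cov S -> st_cov S' ->
  exists2 S'' : sieve U, st_cov S'' &
    forall (V : C) (f : cat_hom V U), S'' V f -> S V f /\ S' V f.
Proof.
move=> covS covS'.
have cl (V W : C) (f : cat_hom V U) (g : cat_hom W V) :
  S V f /\ S' V f -> S W (cat_comp f g) /\ S' W (cat_comp f g).
  by case=> Sf S'f; split; apply: sv_closed.
exists (@Sieve C U (fun V f => S V f /\ S' V f) cl) => //.
apply: (st_trans covS) => V h Sh; apply: (st_super (st_pull h covS')) => W f S'f.
by split=> //; apply: sv_closed.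
Qed.

Lemma match_eq_equiv (U : C) : is_equiv (@match_eq U).
Proof.
split=> [x|x y [S covS xy]|x y z [S covS xy] [S' covS' yz]].
- by exists (mt_sieve x) => [|V f fx]; [apply: mt_cov|exists fx, fx].
- by exists S => // V f /xy[fx [fy e]]; exists fy, fx.
have [S'' covS'' sub] := st_cov_meet covS covS'.
exists S'' => // V f /sub[/xy[fx [fy e]] /yz[fy' [fz e']]].
by exists fx, fz; rewrite e -e' (Prop_irrelevance fy fy').
Qed.

Definition plus_val (U : C) := classes (@match_eq U).
Definition pls (U : C) (x : matching U) : plus_val U := eclass (@match_eq U) x.

Lemma plsP (U : C) (x y : matching U) : pls x = pls y <-> match_eq x y.
Proof. exact: (eclassP (match_eq_equiv U)). Qed.

Lemma rep_pls (U : C) (x : matching U) : match_eq (erep (pls x)) x.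
Proof. exact: (erep_class (match_eq_equiv U)). Qed.

Section Restrict.
Variables (U V : C) (h : cat_hom V U) (x : matching U).
Fact match_res_nat (W Z : C) (f : cat_hom W V) (g : cat_hom Z W)
    (Sf : mt_sieve x W (cat_comp h f)) (Sfg : mt_sieve x Z (cat_comp h (cat_comp f g))) :
  mt_fam Sfg = ps_res F g (mt_fam Sf).
Proof. by move: Sfg; rewrite cat_assoc => Sfg; apply: mt_nat. Qed.

Definition match_res : matching V :=
  @Matching V (pull_sieve (mt_sieve x) h) (st_pull h (mt_cov x))
    (fun W f (Sf : pull_sieve (mt_sieve x) h W f) => mt_fam Sf) match_res_nat.
End Restrict.

Lemma match_res_eq (U V : C) (h : cat_hom V U) (x y : matching U) :
  match_eq x y -> match_eq (match_res h x) (match_res h y).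
Proof.
case=> S covS xy; exists (pull_sieve S h); first exact: st_pull.
by move=> W f Sf; apply: (xy W (cat_comp h f)).
Qed.

Definition plus_res (U V : C) (h : cat_hom V U) (c : plus_val U) : plus_val V :=
  pls (match_res h (erep c)).

Lemma plus_resE (U V : C) (h : cat_hom V U) (x : matching U) :
  plus_res h (pls x) = pls (match_res h x).
Proof. by apply/plsP; apply: match_res_eq; apply: rep_pls. Qed.

Fact plus_res_id (U : C) (c : plus_val U) : plus_res (cat_id U) c = c.
Proof.
elim/eclassW: c => x; rewrite [LHS]plus_resE; apply/plsP.
exists (mt_sieve x) => [|V f fx]; first exact: mt_cov.
have fx' : mt_sieve x V (cat_comp (cat_id U) f) by rewrite cat_id_l.
exists fx', fx; rewrite /=; move: fx'; rewrite cat_id_l => fx'.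
by rewrite (Prop_irrelevance fx fx').
Qed.

Fact plus_res_comp (U V W : C) (f : cat_hom V U) (g : cat_hom W V) (c : plus_val U) :
  plus_res (cat_comp f g) c = plus_res g (plus_res f c).
Proof.
elim/eclassW: c => x; rewrite -/(pls x) !plus_resE; apply/plsP.
exists (pull_sieve (mt_sieve x) (cat_comp f g)); first exact/st_pull/mt_cov.
move=> Z h fx; have fx' : mt_sieve x Z (cat_comp f (cat_comp g h)).
  by move: fx; rewrite /= -cat_assoc.
exists fx, fx'; rewrite /=; move: fx fx'; rewrite /= -cat_assoc => fx fx'.
by rewrite (Prop_irrelevance fx fx').
Qed.

Definition plus : presheaf C := Presheaf plus_res_id plus_res_comp.

Definition unit_match (U : C) (s : F U) : matching U :=
  @Matching U (max_sieve U) (st_max U) (fun V f _ => ps_res F f s)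
    (fun V W f g _ _ => ps_res_comp f g s).

Fact plus_unit_nat (U V : C) (f : cat_hom V U) (s : F U) :
  pls (unit_match (ps_res F f s)) = plus_res f (pls (unit_match s)).
Proof.
rewrite plus_resE; apply/plsP; exists (max_sieve V); first exact: st_max.
by move=> W g _; exists I, I; rewrite /= ps_res_comp.
Qed.

Definition plus_unit : presheaf_hom F plus :=
  @PresheafHom C F plus (fun U s => pls (unit_match s)) plus_unit_nat.
End Plus.

Section PlusMap.
Variables (C : site) (F G : presheaf C) (phi : presheaf_hom F G).

Section One.
Variables (U : C) (x : matching F U).
Fact match_map_nat (V W : C) (f : cat_hom V U) (g : cat_hom W V)
    (Sf : mt_sieve x V f) (Sfg : mt_sieve x W (cat_comp f g)) :
  phi W (mt_fam Sfg) = ps_res G g (phi V (mt_fam Sf)).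
Proof. by rewrite (mt_nat Sf) ph_nat. Qed.

Definition match_map : matching G U :=
  @Matching C G U (mt_sieve x) (mt_cov x) (fun V f Sf => phi V (mt_fam Sf)) match_map_nat.
End One.

Lemma match_map_eq (U : C) (x y : matching F U) :
  match_eq x y -> match_eq (match_map x) (match_map y).
Proof.
case=> S covS xy; exists S => // V f /xy[fx [fy e]].
by exists fx, fy; rewrite /= e.
Qed.

Definition plus_map_fun (U : C) (c : plus F U) : plus G U := pls (match_map (erep c)).

Lemma plus_map_funE (U : C) (x : matching F U) :
  plus_map_fun (pls x) = pls (match_map x).
Proof. by apply/plsP; apply: match_map_eq; apply: rep_pls. Qed.

Fact plus_map_nat (U V : C) (f : cat_hom V U) (c : plus F U) :
  plus_map_fun (ps_res (plus F) f c) = ps_res (plus G) f (plus_map_fun c).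
Proof.
elim/eclassW: c => x; rewrite -/(pls x) plus_map_funE /= !plus_resE plus_map_funE.
congr pls; rewrite /match_map /match_res /=; congr Matching.
exact: Prop_irrelevance.
Qed.

Definition plus_map : presheaf_hom (plus F) (plus G) := PresheafHom plus_map_nat.
End PlusMap.

(* Sheafification by the double plus construction; for presheaves of modules this
   gives the underlying sheaf of sets of the sheafification. *)
Definition sheafify (C : site) (F : presheaf C) : presheaf C := plus (plus F).

Definition sheafify_unit (C : site) (F : presheaf C) (U : C) (s : F U) : sheafify F U :=
  plus_unit (plus F) U (plus_unit F U s).

Definition sheafify_map (C : site) (F G : presheaf C) (phi : presheaf_hom F G) :
  presheaf_hom (sheafify F) (sheafify G) := plus_map (plus_map phi).

(* t is a section over U of the image sheaf of phi *)
Definition in_image_sheaf (C : site) (F G : presheaf C) (phi : presheaf_hom F G)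
    (U : C) (t : G U) : Prop :=
  exists2 S : sieve U, st_cov S &
    forall (V : C) (f : cat_hom V U), S V f -> exists x : F V, phi V x = ps_res G f t.

Record algebra (R : comPzRingType) := Algebra {
  alg_ring :> comPzRingType;
  alg_str : {rmorphism R -> alg_ring} }.
Arguments alg_str {R} a.

Record alg_hom (R : comPzRingType) (A B : algebra R) := AlgHom {
  ah_fun :> {rmorphism A -> B};
  ah_strE : forall a, ah_fun (alg_str A a) = alg_str B a }.

Definition base_alg (R : comPzRingType) : algebra R := @Algebra R R idfun.

Section AlgHom.
Variable R : comPzRingType.

Lemma rmorph_ext (A B : comPzRingType) (f g : {rmorphism A -> B}) : f =1 g -> f = g.
Proof.
case: f => f cf; case: g => g cg /= /funext fg; move: cf cg; rewrite fg.
move=> [[pf] [mf]] [[pg] [mg]].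
by rewrite (Prop_irrelevance pf pg) (Prop_irrelevance mf mg).
Qed.

Lemma alg_hom_ext (A B : algebra R) (f g : alg_hom A B) : f =1 g -> f = g.
Proof.
case: f => f cf; case: g => g cg /= /rmorph_ext fg; move: cf cg; rewrite fg.
by move=> cf cg; rewrite (Prop_irrelevance cf cg).
Qed.

Definition ah_id (A : algebra R) : alg_hom A A :=
  @AlgHom R A A idfun (fun _ => erefl).

Fact ah_comp_str (A B C : algebra R) (g : alg_hom B C) (f : alg_hom A B) a :
  (g \o f) (alg_str A a) = alg_str C a.
Proof. by rewrite /= !ah_strE. Qed.

Definition ah_comp (A B C : algebra R) (g : alg_hom B C) (f : alg_hom A B) : alg_hom A C :=
  @AlgHom R A C (g \o f) (ah_comp_str g f).
End AlgHom.

(* P = B ⊗_A C, that is Spec P = Spec B ×_(Spec A) Spec C *)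
Definition is_pushout (A B C P : comPzRingType) (f : {rmorphism A -> B})
    (g : {rmorphism A -> C}) (p : {rmorphism B -> P}) (q : {rmorphism C -> P}) : Prop :=
  (forall a, p (f a) = q (g a)) /\
  forall (D : comPzRingType) (u : {rmorphism B -> D}) (v : {rmorphism C -> D}),
    (forall a, u (f a) = v (g a)) ->
    exists w : {rmorphism P -> D},
      [/\ forall b, w (p b) = u b, forall c, w (q c) = v c &
        forall w' : {rmorphism P -> D},
          (forall b, w' (p b) = u b) -> (forall c, w' (q c) = v c) -> w' =1 w].

(* B is generated as an A-algebra by finitely many elements *)
Definition finite_type (A B : comPzRingType) (f : {rmorphism A -> B}) : Prop :=
  exists (n : nat) (b : 'I_n -> B), forall P : {pred B}, subring_closed P ->
    (forall a, f a \in P) -> (forall i, b i \in P) -> forall y, y \in P.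

(* An affine Grothendieck topology on Spec R.  Since the structural morphisms are
   affine, the objects of the category are the Spec A with A an R-algebra, and a
   morphism Spec B -> Spec A is a homomorphism A -> B.  Scheme-theoretic fibre
   products are only determined up to isomorphism, hence the existential
   quantifiers in [tp_prod] and [tp_cov_base]; by [tp_cov_iso] the choice of the
   fibre products inside the category is irrelevant.  Neither the structural
   morphism of an object nor the arrow into a fibre product induced by two
   arrows of the category is required to belong to the category. *)
Record affine_topology (R : comPzRingType) := AffineTopology {
  tp_ob : algebra R -> Prop;
  tp_mor : forall A B : algebra R, alg_hom A B -> Prop;
  tp_mor_ob : forall (A B : algebra R) (f : alg_hom A B), tp_mor f -> tp_ob A /\ tp_ob B;
  tp_mor_id : forall A : algebra R, tp_ob A -> tp_mor (ah_id A);
  tp_mor_comp : forall (A B C : algebra R) (g : alg_hom B C) (f : alg_hom A B),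
    tp_mor f -> tp_mor g -> tp_mor (ah_comp g f);
  tp_base : tp_ob (base_alg R);
  tp_prod : forall (A B C : algebra R) (f : alg_hom A B) (g : alg_hom A C),
    tp_mor f -> tp_mor g ->
    exists (P : algebra R) (p : alg_hom B P) (q : alg_hom C P),
      [/\ tp_mor p, tp_mor q & is_pushout f g p q];
  tp_cov : forall (A : algebra R) (I : Type) (B : I -> algebra R),
    (forall i, alg_hom A (B i)) -> Prop;
  tp_cov_mor : forall (A : algebra R) (I : Type) (B : I -> algebra R)
    (f : forall i, alg_hom A (B i)), tp_cov f -> tp_ob A /\ forall i, tp_mor (f i);
  tp_cov_iso : forall (A B : algebra R) (f : alg_hom A B), tp_ob A -> tp_ob B ->
    bijective f -> tp_cov (fun _ : unit => f);
  tp_cov_comp : forall (A : algebra R) (I : Type) (B : I -> algebra R)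
    (f : forall i, alg_hom A (B i)) (J : I -> Type) (C : forall i, J i -> algebra R)
    (g : forall i j, alg_hom (B i) (C i j)),
    tp_cov f -> (forall i, tp_cov (g i)) ->
    tp_cov (fun k : {i & J i} => ah_comp (g (tag k) (tagged k)) (f (tag k)));
  tp_cov_base : forall (A : algebra R) (I : Type) (B : I -> algebra R)
    (f : forall i, alg_hom A (B i)) (C : algebra R) (g : alg_hom A C),
    tp_cov f -> tp_mor g ->
    exists (P : I -> algebra R) (p : forall i, alg_hom (B i) (P i))
        (q : forall i, alg_hom C (P i)),
      [/\ forall i, tp_mor (p i), forall i, is_pushout (f i) g (p i) (q i) & tp_cov q] }.
Arguments tp_ob {R} a A.
Arguments tp_mor {R} a {A B} f.
Arguments tp_cov {R} a {A I B} f.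

Definition of_finite_type (R : comPzRingType) (T : affine_topology R) : Prop :=
  forall (A B : algebra R) (f : alg_hom A B), tp_mor T f -> finite_type f.

(* A' = A ⊗_R S *)
Definition is_base_change (R S : comPzRingType) (f : {rmorphism R -> S})
    (A : algebra R) (A' : algebra S) (h : {rmorphism A -> A'}) : Prop :=
  is_pushout (alg_str A) f h (alg_str A').

Definition induces_site_morphism (R S : comPzRingType) (f : {rmorphism R -> S})
    (TR : affine_topology R) (TS : affine_topology S) : Prop :=
  (forall A : algebra R, tp_ob TR A ->
    exists (A' : algebra S) (h : {rmorphism A -> A'}),
      is_base_change f h /\ tp_ob TS A') /\
  (forall (A : algebra R) (I : Type) (B : I -> algebra R) (g : forall i, alg_hom A (B i)),
    tp_cov TR g ->
    exists (A' : algebra S) (h : {rmorphism A -> A'}) (B' : I -> algebra S)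
        (k : forall i, {rmorphism B i -> B' i}) (g' : forall i, alg_hom A' (B' i)),
      [/\ is_base_change f h, forall i, is_base_change f (k i),
        forall i a, g' i (h a) = k i (g i a) & tp_cov TS g']).

Section TopologySite.
Variables (R : comPzRingType) (T : affine_topology R).

Definition tobj := {A : algebra R | tp_ob T A}.
Definition thom (V U : tobj) := {f : alg_hom (sval U) (sval V) | tp_mor T f}.

Lemma thom_ext (U V : tobj) (f g : thom V U) : sval f =1 sval g -> f = g.
Proof.
case: f => f mf; case: g => g mg /= /alg_hom_ext fg; move: mf mg; rewrite fg.
by move=> mf mg; rewrite (Prop_irrelevance mf mg).
Qed.

Definition thom_id (U : tobj) : thom U U :=
  exist _ (ah_id (sval U)) (tp_mor_id (svalP U)).
Definition thom_comp (U V W : tobj) (f : thom V U) (g : thom W V) : thom W U :=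
  exist _ (ah_comp (sval g) (sval f)) (tp_mor_comp (svalP f) (svalP g)).

Definition tcat : category.
Proof.
by refine (@Category tobj thom thom_id thom_comp _ _ _) => *; apply: thom_ext.
Defined.

(* the Grothendieck topology generated by the coverings *)
Definition tcov (U : tcat) (S : sieve U) : Prop :=
  exists (I : Type) (V : I -> tobj) (f : forall i, thom (V i) U),
    tp_cov T (fun i => sval (f i)) /\ forall i, S (V i) (f i).

Lemma tcov_max (U : tcat) : tcov (max_sieve U).
Proof.
exists unit, (fun=> U), (fun=> thom_id U); split=> //.
by apply: tp_cov_iso; [apply: svalP..|exists idfun].
Qed.

Lemma tcov_pull (U V : tcat) (S : sieve U) (h : cat_hom V U) :
  tcov S -> tcov (pull_sieve S h).
Proof.
case=> I [W [f [covf Sf]]].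
have [P [p [q [mp pq covq]]]] := tp_cov_base covf (svalP h).
have [_ mq] := tp_cov_mor covq.
have obP i : tp_ob T (P i) by have [] := tp_mor_ob (mq i).
pose W' i : tobj := exist _ (P i) (obP i).
exists I, W', (fun i => exist _ (q i) (mq i)); split=> // i /=.
pose p' : @cat_hom tcat (W' i) (W i) := exist _ (p i) (mp i).
suff -> : thom_comp h (exist _ (q i) (mq i) : thom (W' i) V) =
  @cat_comp tcat _ _ _ (f i) p' by apply: sv_closed.
by apply: thom_ext => a /=; rewrite -(proj1 (pq i)).
Qed.

Lemma tcov_trans (U : tcat) (S S' : sieve U) : tcov S ->
  (forall (V : tcat) (h : cat_hom V U), S V h -> tcov (pull_sieve S' h)) -> tcov S'.
Proof.
case=> I [V [f [covf Sf]]] SS'.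
have cov i : exists k : {J : Type & {W : J -> tobj & forall j, thom (W j) (V i)}},
    tp_cov T (fun j => sval (tagged (tagged k) j)) /\
    forall j, S' _ (thom_comp (f i) (tagged (tagged k) j)).
  have [J [W [g [covg S'g]]]] := SS' _ _ (Sf i).
  by exists (existT _ J (existT _ W g)).
pose k i := sval (cid (cov i)); have kP i := svalP (cid (cov i)).
rewrite -/(k _) in kP.
exists {i & tag (k i)}, (fun x => tag (tagged (k (tag x))) (tagged x)).
exists (fun x => thom_comp (f (tag x)) (tagged (tagged (k (tag x))) (tagged x))).
split=> [|x]; last by have [_] := kP (tag x); apply.
by apply: (tp_cov_comp (g := fun i j => sval (tagged (tagged (k i)) j)) covf) => i;
  have [] := kP i.
Qed.

Definition tsite : site := Site tcov_max tcov_pull tcov_trans.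

Definition tbase : tsite := exist _ (base_alg R) (tp_base T).

(* the presheaf Spec A |-> M ⊗_R A *)
Section ModulePresheaf.
Variable M : lmodType R.

Definition mod_ps_val (U : tsite) : Type := tensor (alg_str (sval U)) M.
Definition mod_ps_res (U V : tsite) (f : cat_hom V U) : mod_ps_val U -> mod_ps_val V :=
  tens_map (alg_str (sval V)) idfun (sval f : {rmorphism _ -> _}).

Lemma mod_ps_resE (U V : tsite) (f : cat_hom V U) u :
  mod_ps_res f (tcls _ u) = tcls _ [seq (p.1, sval f p.2) | p <- u].
Proof. by apply: tens_mapE => a; apply: ah_strE. Qed.

Fact mod_ps_res_id (U : tsite) (x : mod_ps_val U) : mod_ps_res (cat_id U) x = x.
Proof.
elim/tclsW: x => u; rewrite mod_ps_resE; congr tcls.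
by rewrite -[RHS]map_id; apply: eq_map => -[].
Qed.

Fact mod_ps_res_comp (U V W : tsite) (f : cat_hom V U) (g : cat_hom W V)
    (x : mod_ps_val U) : mod_ps_res (cat_comp f g) x = mod_ps_res g (mod_ps_res f x).
Proof. by elim/tclsW: x => u; rewrite !mod_ps_resE -map_comp. Qed.

Definition mod_ps : presheaf tsite := Presheaf mod_ps_res_id mod_ps_res_comp.

(* theta : M -> Γ(X_top, M_top), where M = M ⊗_R R *)
Definition theta (m : M) : sheafify mod_ps tbase :=
  @sheafify_unit _ mod_ps tbase (pure (alg_str (base_alg R)) m 1).
End ModulePresheaf.

Section TopClosure.
Variables (M : lmodType R) (N : submodule M).

Fact mod_ps_incl_nat (U V : tsite) (f : cat_hom V U) (x : mod_ps (submod N) U) :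
  tens_incl (ps_res (mod_ps (submod N)) f x) = ps_res (mod_ps M) f (tens_incl x).
Proof.
elim/tclsW: x => u; rewrite /= mod_ps_resE !tens_inclE mod_ps_resE.
by rewrite -!map_comp.
Qed.

Definition mod_ps_incl : presheaf_hom (mod_ps (submod N)) (mod_ps M) :=
  @PresheafHom _ (mod_ps (submod N)) (mod_ps M)
    (fun U => @tens_incl R _ (alg_str (sval U)) M N) mod_ps_incl_nat.

(* theta^-1 of the global sections of the image sheaf of N_top -> M_top *)
Definition top_cl : {pred M} :=
  fun s => `[< in_image_sheaf (sheafify_map mod_ps_incl) (theta s) >].
End TopClosure.
End TopologySite.

Record subcategory := Subcategory {
  sc_in : comPzRingType -> Prop;
  sc_hom : forall R S : comPzRingType, {rmorphism R -> S} -> Prop;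
  sc_hom_in : forall (R S : comPzRingType) (f : {rmorphism R -> S}),
    sc_hom f -> sc_in R /\ sc_in S;
  sc_id : forall R : comPzRingType, sc_in R -> sc_hom (idfun : {rmorphism R -> R});
  sc_comp : forall (R S T : comPzRingType) (f : {rmorphism R -> S}) (g : {rmorphism S -> T}),
    sc_hom f -> sc_hom g -> sc_hom (g \o f : {rmorphism R -> T}) }.
Arguments sc_hom s {R S} f.

Record sc_ob (G : subcategory) := ScOb {
  sc_ring :> comPzRingType;
  sc_ringP : sc_in G sc_ring }.

(* The values are only sets here; that they are submodules is part of [admissible]. *)
Definition closure_assignment (G : subcategory) :=
  forall (R : sc_ob G) (M : lmodType R), submodule M -> {pred M}.

Section Admissible.
Variables (G : subcategory) (c : closure_assignment G).

Definition c_pure (R : sc_ob G) (A : comPzRingType) (f : {rmorphism R -> A}) : Prop :=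
  forall (V : lmodType R) (U : submodule V) (z : V),
    pure f z 1 \in ext_submodule f U -> z \in c U.

Definition admissible : Prop :=
  exists cP : forall (R : sc_ob G) (M : lmodType R) (N : submodule M), submod_closed (c N),
    [/\ forall (R : sc_ob G) (M : lmodType R) (N : submodule M),
          {subset N <= c N} /\ c N =i c (Submodule (cP R M N)),
        forall (R : sc_ob G) (M : lmodType R) (N : submodule M) (s : M)
            (mu nu : nat) (D : 'M[R]_(mu, nu)) (p : {linear 'cV[R]_mu -> quotmod N})
            (t : 'cV[R]_mu),
          is_presentation D p -> p t = qmod_class N s ->
          s \in c N -> c_pure (forcing_str D t)
      & forall (R S : sc_ob G) (f : {rmorphism R -> S}), sc_hom G f ->
          forall (M : lmodType R) (N : submodule M) (m : M),
            m \in c N -> pure f m 1 \in c (ext_submodule f N)].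
End Admissible.

(* Main.v *)
(* Since sheafification changes neither sections nor their equalities locally, s lies in
   the closure of N iff some covering sieve of Spec R consists of algebras A with
   s ⊗ 1 in im(N ⊗ A -> M ⊗ A); idempotence then follows from the locality of covering
   sieves.  By right exactness, s ⊗ 1 in im(N ⊗ A -> M ⊗ A) says that DT = s~ is
   solvable over A, i.e. that R -> A factors through the forcing algebra B, so whatever
   lies in the image after tensoring with B does so after tensoring with every A of the
   sieve.  For persistence the base change of a covering of Spec R is a covering of an
   object isomorphic to Spec S. *)
Require Import Defs.
From HB Require Import structures.
From mathcomp Require Import all_boot all_order all_algebra.
From mathcomp Require Import boolp.

Set Implicit Arguments.
Unset Strict Implicit.
Unset Printing Implicit Defensive.

Import GRing.Theory.
Local Open Scope ring_scope.

(** * Image sheaves under the plus construction *)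

Section ImageSheaf.
Variable C : site.

(** A section of [plus F] is locally a section of [F], and two sections of [plus G] are equal as
    soon as they agree on a covering sieve. A local preimage in [plus F] thus becomes one in [F]
    after a further refinement, and coverings compose. *)
Lemma in_image_plus (F G : presheaf C) (phi : presheaf_hom F G) (U : C) (t : G U) :
  in_image_sheaf (plus_map phi) (plus_unit G U t) <-> in_image_sheaf phi t.
Proof.
split=> [[S covS St]|[S covS St]]; last first.
  exists S => // V f /St[x xt]; exists (plus_unit F V x).
  rewrite -ph_nat -xt; apply: etrans (plus_map_funE phi (unit_match x)) _.
  apply/plsP; exists (max_sieve V); first exact: st_max.
  by move=> W g _; exists I, I; rewrite /= ph_nat.
(* The largest candidate: all arrows along which [t] restricts into the image of [phi]. Naturality
   of [phi] makes it a sieve. *)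
pose S' := @Sieve C U (fun V f => exists x : F V, phi V x = ps_res G f t)
  (fun V W f g '(ex_intro x xt) =>
    ex_intro _ (ps_res F g x)
      (etrans (ph_nat phi g x) (etrans (congr1 _ xt) (esym (ps_res_comp f g t))))).
exists S' => //; apply: (st_trans covS) => V h /St[c].
rewrite -ph_nat; elim/eclassW: c => x.
rewrite -/(pls x) /= (plus_map_funE phi x) => /plsP[S0 covS0 S0e].
apply: (st_super covS0) => W g /S0e[gx [_ /= e]].
by exists (@mt_fam C F V x W g gx); rewrite e ps_res_comp.
Qed.

Lemma in_image_sheafify (F G : presheaf C) (phi : presheaf_hom F G) (U : C) (t : G U) :
  in_image_sheaf (sheafify_map phi) (sheafify_unit t) <-> in_image_sheaf phi t.
Proof.
by split=> [/in_image_plus/in_image_plus|?]; last by do 2!apply/in_image_plus.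
Qed.
End ImageSheaf.

(** * Pure tensors and extended submodules *)

Section TensorTheory.
Variables (R S : comPzRingType) (f : {rmorphism R -> S}) (M : lmodType R).

Lemma tcls_cat (u v : seq (M * S)) : tcls f (u ++ v) = tcls f u + tcls f v.
Proof. by rewrite -taddE. Qed.

Lemma tcls_cons (p : M * S) u : tcls f (p :: u) = pure f p.1 p.2 + tcls f u.
Proof. by rewrite -cat1s tcls_cat /pure; case: p. Qed.

Lemma pureDl m m' s : pure f (m + m') s = pure f m s + pure f m' s :> tensor f M.
Proof. by rewrite /pure -tcls_cat; apply/tclsP/tr_addl. Qed.

Lemma pureDr (m : M) s s' : pure f m (s + s') = pure f m s + pure f m s'.
Proof. by rewrite /pure -tcls_cat; apply/tclsP/tr_addr. Qed.

Lemma pureZl a m s : pure f (a *: m) s = pure f m (f a * s) :> tensor f M.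
Proof. exact/tclsP/tr_bal. Qed.

Lemma scale_pure a (m : M) s : a *: pure f m s = pure f m (a * s).
Proof. by rewrite /GRing.scale /= tscaleE. Qed.

(** Existence half of the universal property of the tensor product, stated on representing lists so
    that no induced map has to be built. *)
Lemma tens_rel_bilinear (Z : zmodType) (b : M -> S -> Z) (u v : seq (M * S)) :
  (forall s, {morph b^~ s : m m' / m + m'}) -> (forall m, {morph b m : s s' / s + s'}) ->
  (forall a m s, b (a *: m) s = b m (f a * s)) ->
  tens_rel f u v -> \sum_(p <- u) b p.1 p.2 = \sum_(p <- v) b p.1 p.2.
Proof.
move=> bDl bDr bZ; elim=> // {u v} [u v w _ -> _ -> //|u u' v v' _ e _ e'|u v|s|m m' s|m s s'|a m s].
- by rewrite !big_cat /= e e'.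
- by rewrite !big_cat /= addrC.
- have := bDl s 0 0; rewrite addr0 big_cons big_nil addr0 => /eqP.
  by rewrite -subr_eq0 opprD addNKr oppr_eq0 => /eqP.
- by rewrite !big_cons big_nil /= bDl addrA.
- by rewrite !big_cons big_nil /= bDr addrA.
by rewrite !big_cons big_nil /= bZ.
Qed.

Variable N : submodule M.

Lemma pure_ext (m : M) s : m \in N -> pure f m s \in ext_submodule f N.
Proof.
move=> Nm; apply/asboolP; exists (tcls f [:: (exist _ m Nm : submod N, s)]).
by rewrite tens_inclE.
Qed.

(** Each [pure f m s] is [s] times [pure f m 1]. Asking only for [pure f p.1 1] in the extension,
    rather than [p.1] in [N], is the form needed for idempotence, where membership is merely
    local. *)
Lemma tcls_ext (u : seq (M * S)) :
  {in u, forall p, pure f p.1 1 \in ext_submodule f N} -> tcls f u \in ext_submodule f N.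
Proof.
elim: u => [|p u IHu] Nu; first exact: (rpred0 (ext_submodule f N)).
rewrite tcls_cons; apply: rpredD; last by apply: IHu => q uq; apply: Nu; rewrite inE uq orbT.
by rewrite -[p.2]mulr1 -scale_pure; apply: rpredZ; apply: Nu; rewrite inE eqxx.
Qed.

Lemma mem_extP (y : tensor f M) :
  y \in ext_submodule f N <->
  exists2 u : seq (M * S), {in u, forall p, p.1 \in N} & y = tcls f u.
Proof.
split=> [/asboolP[x <-]|[u Nu ->]]; last by apply: tcls_ext => p /Nu; apply: pure_ext.
elim/tclsW: x => u; rewrite tens_inclE; eexists; last by [].
by move=> _ /mapP[p _ ->] /=; apply: valP.
Qed.
End TensorTheory.

Lemma qmod_class_eq0 (R : comPzRingType) (M : lmodType R) (N : submodule M) (x : M) :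
  qmod_class N x = 0 <-> x \in N.
Proof.
have <- : qmod_class N 0 = 0 by apply: (addrI (qmod_class N 0)); rewrite -qmod_classD !addr0.
by rewrite -[x in _ <-> x \in _]subr0; apply: qmod_classP.
Qed.

Section ExtensionTheory.
Variables (R S S' : comPzRingType) (f : {rmorphism R -> S}) (f' : {rmorphism R -> S'}).
Variables (g : {rmorphism S -> S'}) (gf : forall a, g (f a) = f' a).
Variables (M : lmodType R) (N : submodule M).

Lemma tens_map_ext (y : tensor f M) :
  y \in ext_submodule f N -> tens_map f' idfun g y \in ext_submodule f' N.
Proof.
move=> /mem_extP[u Nu ->]; rewrite tens_mapE //; apply/mem_extP.
by eexists; last by []; move=> _ /mapP[p /Nu Np ->].
Qed.

Lemma pure_ext_rmorph m :
  pure f m 1 \in ext_submodule f N -> pure f' m 1 \in ext_submodule f' N.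
Proof. by move=> /tens_map_ext; rewrite tens_mapE //= rmorph1. Qed.
End ExtensionTheory.

(** The map from [M ⊗_R B] to [(M ⊗_R S) ⊗_S B'] sending [n ⊗ c] to [(n ⊗ 1) ⊗ k c] carries the
    image of [N ⊗_R B] into the iterated extension. For persistence, [B'] is the base change of a
    member [B] of a covering. *)
Lemma pure_ext_ext (R S B B' : comPzRingType) (f : {rmorphism R -> S})
    (b : {rmorphism R -> B}) (b' : {rmorphism S -> B'}) (k : {rmorphism B -> B'})
    (M : lmodType R) (N : submodule M) (m : M) :
  (forall a, k (b a) = b' (f a)) -> pure b m 1 \in ext_submodule b N ->
  pure b' (pure f m 1) 1 \in ext_submodule b' (ext_submodule f N).
Proof.
move=> kb /mem_extP[u Nu /tclsP mu].
pose F (n : M) c : tensor b' (tensor f M) := pure b' (pure f n 1) (k c).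
suff: F m 1 \in ext_submodule b' (ext_submodule f N) by rewrite /F rmorph1.
have := tens_rel_bilinear (b := F) _ _ _ mu; rewrite big_cons big_nil addr0 => ->.
- rewrite big_seq; elim/big_ind: _ => [|x y|p /Nu Np]; [exact: rpred0|exact: rpredD|].
  by do 2!apply: pure_ext.
- by move=> c n n'; rewrite /F pureDl pureDl.
- by move=> n c c'; rewrite /F rmorphD pureDr.
(* Balancedness is where the commuting square enters: [k (b a)] equals [b' (f a)], a scalar from [S]
   that moves across the outer tensor sign. *)
move=> a n c; rewrite /F rmorphM kb pureZl mulr1 -pureZl.
by rewrite scale_pure mulr1.
Qed.

(** * The induced closure: extensivity, submodule property, idempotence *)

Section TopClosureTheory.
Variables (R : comPzRingType) (T : affine_topology R) (M : lmodType R).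

Lemma top_clP (N : submodule M) s :
  s \in top_cl T N <->
  exists2 S : sieve (tbase T), st_cov S &
    forall (V : tsite T) (h : cat_hom V (tbase T)), S V h ->
      pure (alg_str (sval V)) s 1 \in ext_submodule (alg_str (sval V)) N.
Proof.
have res (V : tsite T) (h : cat_hom V (tbase T)) :
    ps_res (mod_ps T M) h (pure (alg_str (base_alg R)) s 1 : mod_ps T M (tbase T)) =
    pure (alg_str (sval V)) s 1 by rewrite /= mod_ps_resE /= rmorph1.
split=> [/asboolP/in_image_sheafify[S covS Ss]|[S covS Ss]].
  by exists S => // V h /Ss[x]; rewrite res => xs; apply/asboolP; exists x.
apply/asboolP/in_image_sheafify; exists S => // V h /Ss/asboolP[x xs].
by exists x; rewrite res.
Qed.

Lemma sub_top_cl (N : submodule M) : {subset N <= top_cl T N}.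
Proof.
move=> s Ns; apply/top_clP; exists (max_sieve (tbase T)); first exact: st_max.
by move=> V h _; apply: pure_ext.
Qed.

Lemma top_cl_closed (N : submodule M) : submod_closed (top_cl T N).
Proof.
split=> [|a s s' /top_clP[S covS Ss] /top_clP[S' covS' Ss']].
  by apply: sub_top_cl; apply: (rpred0 N).
have [S'' covS'' sub] := st_cov_meet covS covS'.
apply/top_clP; exists S'' => // V h /sub[/Ss es /Ss' es'].
rewrite pureDl pureZl -scale_pure.
by apply: rpredD => //; apply: rpredZ.
Qed.

(** Finitely many covering sieves have a common covering refinement; the list will be the one
    representing a tensor. *)
Lemma top_cl_seq (N : submodule M) (X : eqType) (u : seq X) (F : X -> M) :
    {in u, forall x, F x \in top_cl T N} ->
  exists2 S : sieve (tbase T), st_cov S &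
    forall (V : tsite T) (h : cat_hom V (tbase T)), S V h -> {in u, forall x,
      pure (alg_str (sval V)) (F x) 1 \in ext_submodule (alg_str (sval V)) N}.
Proof.
elim: u => [|x u IHu] uN; first by exists (max_sieve (tbase T)); first exact: st_max.
have [|S covS Su] := IHu; first by move=> y yu; apply: uN; rewrite inE yu orbT.
have /top_clP[S' covS' S'x] : F x \in top_cl T N by apply: uN; rewrite inE eqxx.
have [S'' covS'' sub] := st_cov_meet covS covS'.
exists S'' => // V h /sub[/Su eu /S'x ex] y; rewrite inE => /orP[/eqP->//|].
exact: eu.
Qed.

Lemma top_cl_idem (N : submodule M) :
  top_cl T N =i top_cl T (Submodule (top_cl_closed N)).
Proof.
move=> s; apply/idP/idP => [|/top_clP[S covS Ss]].
  exact: (@sub_top_cl (Submodule (top_cl_closed N))).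
(* Over [V] the tensor [s ⊗ 1] is a finite sum of [n ⊗ a] with [n] in the closure. A sieve on the
   base that serves all these [n] is pulled back to [V]. *)
have cov V h (Sh : S V h) : exists2 S' : sieve V, st_cov S' & forall W (g : cat_hom W V),
    S' W g -> pure (alg_str (sval W)) s 1 \in ext_submodule (alg_str (sval W)) N.
  have /mem_extP[u Nu us] := Ss V h Sh.
  have [S0 covS0 S0u] := top_cl_seq Nu.
  exists (pull_sieve S0 h) => [|W g /S0u Wu]; first exact: st_pull.
  have -> : pure (alg_str (sval W)) s 1 =
      mod_ps_res (M := M) g (pure (alg_str (sval V)) s 1).
    by rewrite mod_ps_resE /= rmorph1.
  rewrite us mod_ps_resE; apply: tcls_ext => _ /mapP[p /Wu Wp ->].
  exact: Wp.
(* The condition depends on the object only, not on its arrow to the base, and persists along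
   arrows; so it defines a sieve, which is locally covering by [cov]. *)
have cl (V W : tsite T) (h : cat_hom V (tbase T)) (g : cat_hom W V) :
    pure (alg_str (sval V)) s 1 \in ext_submodule (alg_str (sval V)) N ->
    pure (alg_str (sval W)) s 1 \in ext_submodule (alg_str (sval W)) N.
  by apply: pure_ext_rmorph => a; apply: (ah_strE (sval g)).
apply/top_clP; exists (Sieve cl) => //.
by apply: (st_trans covS) => V h /cov[S' covS' S's]; apply: (st_super covS').
Qed.
End TopClosureTheory.

(** * Homomorphisms out of a presented algebra *)

Section PresentedAlgebraHom.
Variables (R A : comPzRingType) (f : {rmorphism R -> A}) (n : nat).
Variables (v : 'I_n -> A) (E : pterm R n -> pterm R n -> Prop).

Fixpoint pterm_eval (t : pterm R n) : A :=
  match t with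
  | PConst a => f a
  | PVar i => v i
  | PAdd x y => pterm_eval x + pterm_eval y
  | POpp x => - pterm_eval x
  | PMul x y => pterm_eval x * pterm_eval y
  end.

Hypothesis Ev : forall x y, E x y -> pterm_eval x = pterm_eval y.

Lemma pterm_eval_rel x y : pres_rel E x y -> pterm_eval x = pterm_eval y.
Proof.
elim=> //= {x y} [x y z _ -> _ -> //|x x' y y' _ -> _ -> //|x x' _ -> //|
  x x' y y' _ -> _ -> //|x y z|x y|x|x|x y z|x y|x|x y z|a b|a b].
- exact: addrA.
- exact: addrC.
- by rewrite rmorph0 add0r.
- by rewrite rmorph0 addNr.
- exact: mulrA.
- exact: mulrC.
- by rewrite rmorph1 mul1r.
- exact: mulrDl.
- exact: rmorphD.
- exact: rmorphM.
Qed.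

(** Evaluation of a representative is well defined, since every rule generating [pres_rel] holds in
    [A]. *)
Lemma pres_alg_lift :
  exists g : {rmorphism pres_alg E -> A}, forall t, g (pcls E t) = pterm_eval t.
Proof.
pose ev (x : pres_alg E) := pterm_eval (rep x).
have evE t : ev (pcls E t) = pterm_eval t by apply/pterm_eval_rel/rep_pcls.
have evD : nmod_morphism ev.
  split=> [|x y]; first by rewrite evE /= rmorph0.
  elim/pclsW: x => x; elim/pclsW: y => y.
  by rewrite /GRing.add /= paddE !evE.
have evM : monoid_morphism ev.
  split=> [|x y]; first by rewrite evE /= rmorph1.
  elim/pclsW: x => x; elim/pclsW: y => y.
  by rewrite /GRing.mul /= pmulE !evE.
pose evadd := GRing.isNmodMorphism.Build (pres_alg E) A ev evD.
pose evmul := GRing.isMonoidMorphism.Build (pres_alg E) A ev evM.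
pose g : {rmorphism pres_alg E -> A} := HB.pack ev evadd evmul.
by exists g.
Qed.
End PresentedAlgebraHom.

(** * Forcing algebras and linear systems *)

Section Forcing.
Variables (R A : comPzRingType) (f : {rmorphism R -> A}).
Variables (mu nu : nat) (D : 'M[R]_(mu, nu)).

(** Sending the variables to the entries of [v] turns the [j]-th defining relation into the [j]-th
    row of the system. *)
Lemma forcing_eval (t : 'cV[R]_mu) (v : 'cV[A]_nu) : map_mx f D *m v = map_mx f t ->
  exists g : {rmorphism forcing_alg D t -> A}, forall a, g (forcing_str D t a) = f a.
Proof.
move=> Dv; have Ev (x y : pterm R nu) : forcing_rel D t x y ->
    pterm_eval f (v^~ 0) x = pterm_eval f (v^~ 0) y.
  move=> [j [-> ->]] /=; have /matrixP/(_ j 0) := Dv; rewrite !mxE => <-.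
  rewrite /forcing_lhs -big_enum /=; elim: (enum _) => [|i s IHs] /=.
    by rewrite big_nil rmorph0.
  by rewrite big_cons IHs mxE.
have [g gE] := pres_alg_lift Ev; exists g => a; exact: gE.
Qed.

(** When [D] presents [M/N], the quotient of [A^mu] by this submodule is [(M/N) ⊗_R A]. *)
Definition mulmx_image : {pred 'cV[A]_mu} :=
  fun x => `[< exists v, x = map_mx f D *m v >].

Lemma mulmx_image_closed : submod_closed mulmx_image.
Proof.
split=> [|a _ _ /asboolP[v ->] /asboolP[w ->]]; apply/asboolP.
  by exists 0; rewrite mulmx0.
by exists (a *: v + w); rewrite mulmxDr scalemxAr.
Qed.

Lemma presentation_solution (M : lmodType R) (N : submodule M)
    (p : {linear 'cV[R]_mu -> quotmod N}) (t : 'cV[R]_mu) (s : M) :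
  is_presentation D p -> p t = qmod_class N s -> pure f s 1 \in ext_submodule f N ->
  exists v : 'cV[A]_nu, map_mx f D *m v = map_mx f t.
Proof.
move=> [psurj pker] pt /mem_extP[u Nu /tclsP su].
pose lift m := sval (cid (psurj (qmod_class N m))).
have liftP m : p (lift m) = qmod_class N m by apply: (svalP (cid (psurj (qmod_class N m)))).
pose Q := Submodule mulmx_image_closed.
(* [lift] is chosen pointwise and need not be linear, but two vectors with the same image under [p]
   differ by some [D *m v], so it becomes linear modulo [Q]. *)
have eqQ (x y : 'cV[R]_mu) a : p x = p y ->
    qmod_class Q (a *: map_mx f x) = qmod_class Q (a *: map_mx f y).
  move=> xy; apply/qmod_classP; rewrite -scalerBr; apply: rpredZ.
  have /pker[v xyv] : p (x - y) = 0 by rewrite linearB /= xy subrr.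
  by apply/asboolP; exists (map_mx f v); rewrite -map_mxM -xyv map_mxB.
(* b induces M ⊗ A -> A^mu / D A^nu, which kills the image of N ⊗ A. *)
pose b m a := qmod_class Q (a *: map_mx f (lift m)).
have := tens_rel_bilinear (b := b) _ _ _ su.
rewrite big_cons big_nil addr0 big1_seq /= => [e|q /Nu Nq]; last first.
  have -> : b q.1 q.2 = qmod_class Q (q.2 *: map_mx f 0).
    by apply: eqQ; rewrite linear0 liftP; apply/qmod_class_eq0.
  by rewrite map_mx0 scaler0; apply/qmod_class_eq0; apply: (rpred0 Q).
have : b s 1 = 0.
  apply: e => [a m m'|m a a'|c m a].
  - by rewrite /b -qmod_classD -scalerDr -map_mxD; apply: eqQ;
      rewrite linearD !liftP qmod_classD.
  - by rewrite /b scalerDl qmod_classD.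
  rewrite /b mulrC -scalerA -map_mxZ; apply: eqQ.
  by rewrite linearZ !liftP; symmetry; apply: qmod_scaleE.
(* Both [lift s] and [t] lie over the class of [s], so the vanishing of [b s 1] says that [t]
   becomes a multiple of [D] over [A]. *)
rewrite /b (eqQ _ t) ?liftP // scale1r => /qmod_class_eq0/asboolP[v ->].
by exists v.
Qed.
End Forcing.

(** The sieve that witnesses [s] in the closure of [N] also witnesses [z] in the closure of [U]. *)
Lemma top_cl_forcing (R : comPzRingType) (T : affine_topology R) (M : lmodType R)
    (N : submodule M) (s : M) (mu nu : nat) (D : 'M[R]_(mu, nu))
    (p : {linear 'cV[R]_mu -> quotmod N}) (t : 'cV[R]_mu) (V : lmodType R)
    (U : submodule V) (z : V) :
  is_presentation D p -> p t = qmod_class N s -> s \in top_cl T N ->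
  pure (forcing_str D t) z 1 \in ext_submodule (forcing_str D t) U -> z \in top_cl T U.
Proof.
move=> presD pt /top_clP[S covS Ss] Uz; apply/top_clP; exists S => // W h /Ss sW.
have [v /forcing_eval[g gE]] := presentation_solution presD pt sW.
exact (pure_ext_rmorph gE Uz).
Qed.

(** * Persistence under base change *)

Lemma pushout_id_bij (A C P : comPzRingType) (g : {rmorphism A -> C})
    (p : {rmorphism A -> P}) (q : {rmorphism C -> P}) :
  is_pushout (idfun : {rmorphism A -> A}) g p q -> bijective q.
Proof.
move=> [pq univ]; have [|w [wp wq _]] := univ C g idfun; first by [].
exists w => // x.
(* Uniqueness for maps from [P] to itself identifies [q \o w] with the identity, both being
   compatible with [p] and [q]. *)
have [w' [_ _ uniq]] := univ P p q pq.
have qw : q \o w =1 w'.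
  apply: (uniq (q \o w : {rmorphism P -> P})) => [a|c] /=; last by rewrite wq.
  by rewrite wp -pq.
by rewrite -[LHS]/((q \o w) x) qw -(uniq idfun).
Qed.

Lemma top_cl_persistent (R S : comPzRingType) (f : {rmorphism R -> S})
    (TR : affine_topology R) (TS : affine_topology S) (M : lmodType R)
    (N : submodule M) (m : M) :
  induces_site_morphism f TR TS -> m \in top_cl TR N ->
  pure f m 1 \in top_cl TS (ext_submodule f N).
Proof.
move=> [_ site] /top_clP[K [I [V [g [covg Kg]]]] Km].
have [A' [h [B' [k [g' [pA pB g'h covg']]]]]] := site _ _ _ _ covg.
have [obA' morg'] := tp_cov_mor covg'.
(* The base change [A'] of the base object is only isomorphic to [S]; prefixing the covering of [A']
   with this isomorphism gives one of the base object itself. *)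
pose iso : alg_hom (base_alg S) A' := @AlgHom S (base_alg S) A' (alg_str A') (fun=> erefl).
have covi : tp_cov TS (fun _ : unit => iso).
  by apply: tp_cov_iso => //; [exact: tp_base|exact: pushout_id_bij pA].
have covc := tp_cov_comp covi (fun=> covg').
have [_ morc] := tp_cov_mor covc.
pose W (x : {_ : unit & I}) : tobj TS := exist _ (B' (tagged x)) (tp_mor_ob (morc x)).2.
pose w x : thom (W x) (tbase TS) := exist _ _ (morc x).
have cl (X Y : tsite TS) (a : cat_hom X (tbase TS)) (b : cat_hom Y X) :
    pure (alg_str (sval X)) (pure f m 1) 1
      \in ext_submodule (alg_str (sval X)) (ext_submodule f N) ->
    pure (alg_str (sval Y)) (pure f m 1) 1
      \in ext_submodule (alg_str (sval Y)) (ext_submodule f N).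
  by apply: pure_ext_rmorph => c; apply: (ah_strE (sval b)).
apply/top_clP; exists (Sieve cl) => //; exists _, W, w; split=> // x /=.
exact (pure_ext_ext (pB (tagged x)).1 (Km _ _ (Kg (tagged x)))).
Qed.

Theorem theorem2p4p8 (G : subcategory) (T : forall R : sc_ob G, affine_topology R)
    (T_ft : forall R : sc_ob G, of_finite_type (T R))
    (T_site : forall (R S : sc_ob G) (f : {rmorphism R -> S}),
       sc_hom G f -> induces_site_morphism f (T R) (T S)) :
  admissible (fun (R : sc_ob G) (M : lmodType R) (N : submodule M) => top_cl (T R) N).
Proof.
exists (fun R M N => top_cl_closed (T R) N); split.
- by move=> R M N; split; [apply: sub_top_cl|apply: top_cl_idem].
- move=> R M N s mu nu D p t presD pt sN V U z.
  exact: top_cl_forcing presD pt sN.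
by move=> R S f /T_site fsite M N m; apply: top_cl_persistent.
Qed.
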